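(* Let $N\in\sum_{k=1}^K F_k$ and let $u_k^*\in F_k$ ($k\in[K]$) be such that $N=\sum_k u_k^*$ and $\psi(N)=-\sum_k\langle\rho_k,u_k^*\rangle$. Let $G$ be the valuated oriented graph associated with $(u_k^* )_k$, with weights $w_{\alpha\beta}$ (defined in the context). Let $i,j\in[n]$ and suppose there exists a path in $G$ with finite valuation from $i$ to $j$. Then $N-e_i+e_j\in\sum_{k=1}^K F_k$. Moreover, $G$ has no negative cycle and there is a shortest path from $i$ to $j$. Let $\alpha_0\to\alpha_1\to\dots\to\alpha_p$ with $\alpha_0=i$, $\alpha_p=j$ be any shortest path from $i$ to $j$, let $(k_u)_{0\le u\le p-1}$ be any sequence in $[K]$ such that $w^{k_u}_{\alpha_u\alpha_{u+1}}=w_{\alpha_u\alpha_{u+1}}$ for all $0\le u\le p-1$, and define, for $k\in[K]$, $$v_k^*=u_k^*+\sum_{0\le u\le p-1,\ k_u=k}\big(-e_{\alpha_u}+e_{\alpha_{u+1}}\big)$$ (so $v_k^*=u_k^*$ if $k\notin\{k_0,\dots,k_{p-1}\}$). Then $\psi(N-e_i+e_j)=-\sum_{k=1}^K\langle\rho_k,v_k^*\rangle$.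
   Context: $[m]=\{1,\dots,m\}$; $e_i$ is the $i$-th canonical basis vector of $\mathbb{R}^n$. Let $n,K\ge 1$ be integers. For each $k\in[K]$ let $\mathcal{J}_k\subset[n]$, let $R_k$ be a nonnegative integer, and let $\rho_k\in(\mathbb{R}\cup\{-\infty\})^n$ with $\rho_k(i)=-\infty$ if and only if $i\in\mathcal{J}_k$. Set $F_k=\{u\in\{0,1\}^n : \sum_{i=1}^n u(i)=R_k,\ u(i)=0\ \forall i\in\mathcal{J}_k\}$ and let $\Delta_k$ be the convex hull of $F_k$. In scalar products the convention $(-\infty)\cdot 0=0$ is used. $\varphi_k(u)=-\langle\rho_k,u\rangle$ if $u\in\Delta_k$ and $+\infty$ otherwise; $\psi$ is the inf-convolution of the $\varphi_k$: $\psi(N)=\inf\{\sum_k\varphi_k(u_k) : \sum_k u_k=N\}$. Graph $G$: for $k\in[K]$ and $\alpha,\beta\in[n]$ set $w^k_{\alpha\beta}=\rho_k(\alpha)-\rho_k(\beta)$ if $u_k^*(\alpha)=1$ and $u_k^*(\beta)=0$ (which equals $+\infty$ if $\beta\in\mathcal{J}_k$), and $w^k_{\alpha\beta}=+\infty$ otherwise; $w_{\alpha\beta}=\min_{k\in[K]}w^k_{\alpha\beta}$. $G$ has vertex set $[n]$ and an oriented edge from $\alpha$ to $\beta$ of value $w_{\alpha\beta}$ for all $\alpha,\beta$. The valuation (length) of a path or cycle is the sum of the values of its edges. A path visits no vertex twice. *)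

(* Defs.v *)
From HB Require Import structures.
From mathcomp Require Export all_boot all_order all_algebra.
From mathcomp Require Export all_classical all_reals all_analysis.

Set Implicit Arguments.
Unset Strict Implicit.
Unset Printing Implicit Defensive.

Import Order.TTheory GRing.Theory Num.Theory.

Local Open Scope classical_set_scope.
Local Open Scope ring_scope.

Definition basis_vec (R : realType) (n : nat) (i : 'I_n) : 'rV[R]_n :=
  delta_mx 0 i.

Definition convex_hull (R : realType) (n : nat) (A : set 'rV[R]_n) :
    set 'rV[R]_n :=
  [set x | exists (m : nat) (c : 'I_m -> R) (y : 'I_m -> 'rV[R]_n),
     [/\ forall l, 0 <= c l, \sum_(l < m) c l = 1, forall l, A (y l)
       & x = \sum_(l < m) c l *: y l]].

Definition set_sum (R : realType) (n K : nat) (A : 'I_K -> set 'rV[R]_n) :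
    set 'rV[R]_n :=
  [set x | exists u : 'I_K -> 'rV[R]_n,
     (forall k, A k (u k)) /\ x = \sum_(k < K) u k].

Definition feasible (R : realType) (n : nat) (J : {set 'I_n}) (r : nat) :
    set 'rV[R]_n :=
  [set u | [/\ forall i, u 0 i = 0 \/ u 0 i = 1, \sum_(i < n) u 0 i = r%:R
             & forall i, i \in J -> u 0 i = 0]].

(* In [\bar R] one has [-oo * 0 = 0], as the convention for scalar products
   requires. *)
Definition pairing (R : realType) (n : nat) (rho : 'I_n -> \bar R)
    (u : 'rV[R]_n) : \bar R :=
  (\sum_(i < n) rho i * (u 0 i)%:E)%E.

Definition cost (R : realType) (n : nat) (J : {set 'I_n}) (r : nat)
    (rho : 'I_n -> \bar R) (u : 'rV[R]_n) : \bar R :=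
  if u \in convex_hull (feasible J r) then (- pairing rho u)%E else +oo%E.

Definition inf_convolution (R : realType) (n K : nat)
    (phi : 'I_K -> 'rV[R]_n -> \bar R) (x : 'rV[R]_n) : \bar R :=
  ereal_inf [set y | exists u : 'I_K -> 'rV[R]_n,
    \sum_(k < K) u k = x /\ y = (\sum_(k < K) phi k (u k))%E].

Definition edge_weight (R : realType) (n : nat) (rho : 'I_n -> \bar R)
    (u : 'rV[R]_n) (a b : 'I_n) : \bar R :=
  if (u 0 a == 1) && (u 0 b == 0) then (rho a - rho b)%E else +oo%E.

(* The neutral element [+oo] does not affect the minimum when [0 < K]. *)
Definition graph_weight (R : realType) (n K : nat)
    (rho : 'I_K -> 'I_n -> \bar R) (u : 'I_K -> 'rV[R]_n) (a b : 'I_n) :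
    \bar R :=
  \big[Order.min/+oo%E]_(k < K) edge_weight (rho k) (u k) a b.

(* A path or cycle with [p] edges is given by [alpha : nat -> 'I_n], of which
   only the values [alpha 0, ..., alpha p] matter. *)
Definition valuation (R : realType) (n : nat) (w : 'I_n -> 'I_n -> \bar R)
    (p : nat) (alpha : nat -> 'I_n) : \bar R :=
  (\sum_(0 <= t < p) w (alpha t) (alpha t.+1))%E.

(* The case [p = 0], hence [i = j], is allowed. *)
Definition is_path (n : nat) (i j : 'I_n) (p : nat) (alpha : nat -> 'I_n) :
    Prop :=
  [/\ alpha 0%N = i, alpha p = j
    & forall s t, (s <= p)%N -> (t <= p)%N -> alpha s = alpha t -> s = t].

Definition is_shortest_path (R : realType) (n : nat)
    (w : 'I_n -> 'I_n -> \bar R) (i j : 'I_n) (p : nat) (alpha : nat -> 'I_n) :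
    Prop :=
  is_path i j p alpha /\
  forall q beta, is_path i j q beta ->
    (valuation w p alpha <= valuation w q beta)%E.

(* Intermediate vertices may be repeated, so that simple cycles are covered in
   particular. *)
Definition is_cycle (n : nat) (p : nat) (alpha : nat -> 'I_n) : Prop :=
  (0 < p)%N /\ alpha p = alpha 0%N.

Definition no_negative_cycle (R : realType) (n : nat)
    (w : 'I_n -> 'I_n -> \bar R) : Prop :=
  ~ exists p alpha, is_cycle p alpha /\ (valuation w p alpha < 0)%E.

Definition exchange (R : realType) (n K : nat) (u : 'I_K -> 'rV[R]_n) (p : nat)
    (alpha : nat -> 'I_n) (ks : 'I_p -> 'I_K) (k : 'I_K) : 'rV[R]_n :=
  u k + \sum_(t < p | ks t == k)
          (- basis_vec R (alpha t) + basis_vec R (alpha t.+1)).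

(* Main.v *)
(* Moving units along a simple path or cycle of the graph keeps every [ustar k]
   feasible, since an index cannot both lose and gain a unit of the same [k],
   and it changes the cost by the valuation. Optimality of [ustar] therefore
   makes simple cycles nonnegative, which yields potentials [d] with
   [d b <= d a + w a b]. For such a [d], each [ustar k] maximises [rho k + d]
   over the feasible set [k]. Choosing [d] with [d j - d i] equal to the length of
   a shortest path from [i] to [j] and summing over [k] gives the lower bound on
   [psi (N - e_i + e_j)] that the exchange along a shortest path attains. *)
Require Import Defs.
From mathcomp Require Import zify ring lra.

Set Implicit Arguments.
Unset Strict Implicit.
Unset Printing Implicit Defensive.

Import Order.TTheory GRing.Theory Num.Theory.
Local Open Scope classical_set_scope.
Local Open Scope ring_scope.

(** * Simple walks and simple cycles *)

Definition simple_walk (n p : nat) (alpha : nat -> 'I_n) : Prop :=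
  forall s t, (s <= p)%N -> (t <= p)%N -> alpha s = alpha t -> s = t.

Definition simple_cycle (n p : nat) (alpha : nat -> 'I_n) : Prop :=
  [/\ (0 < p)%N, alpha p = alpha 0%N
    & forall s t, (s < p)%N -> (t < p)%N -> alpha s = alpha t -> s = t].

Lemma simple_walk_ltn (n p : nat) (alpha : nat -> 'I_n) :
  simple_walk p alpha -> (p < n)%N.
Proof.
move=> inj_a; have inj_f : injective (fun s : 'I_p.+1 => alpha s).
  by move=> s t /inj_a st; apply/val_inj/st; rewrite -ltnS.
by have := leq_card _ inj_f; rewrite !card_ord.
Qed.

(** The index [p] wraps around to [0], so the heads of the edges of a simple cycle are as distinct
    as their tails: no vertex gains two units. *)
Lemma simple_cycle_next_inj (n p : nat) (alpha : nat -> 'I_n) (s t : nat) :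
  simple_cycle p alpha -> (s < p)%N -> (t < p)%N ->
  alpha s.+1 = alpha t.+1 -> s = t.
Proof.
move=> [p0 ap inj_a] sp tp.
have [s1|s1] := ltnP s.+1 p; have [t1|t1] := ltnP t.+1 p.
- by move=> /inj_a -/(_ s1 t1) [].
- have -> : t.+1 = p by lia.
  by rewrite ap => /inj_a -/(_ s1 p0).
- have -> : s.+1 = p by lia.
  by rewrite ap => /inj_a -/(_ p0 t1).
- by move=> _; lia.
Qed.

(** * Shortest walks and potentials in a weighted graph *)

Section Valuation.
Variables (R : realType) (n : nat).
Implicit Types (w : 'I_n -> 'I_n -> \bar R) (alpha beta : nat -> 'I_n).

Lemma valuationS w p alpha :
  valuation w p.+1 alpha = (valuation w p alpha + w (alpha p) (alpha p.+1))%E.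
Proof. by rewrite /valuation big_nat_recr. Qed.

Lemma valuationD w p q alpha :
  valuation w (p + q) alpha =
  (valuation w p alpha + valuation w q (fun t => alpha (p + t)%N))%E.
Proof.
elim: q => [|q IH]; first by rewrite addn0 [X in (_ + X)%E]/valuation big_nil adde0.
by rewrite addnS !valuationS IH addeA addnS.
Qed.

Lemma eq_valuation w p alpha beta :
  (forall t, (t <= p)%N -> alpha t = beta t) ->
  valuation w p alpha = valuation w p beta.
Proof.
move=> ab; apply: eq_big_nat => t /andP[_ tp].
by rewrite !ab // ltnW.
Qed.

Lemma eq_valuation_weight w1 w2 p alpha :
  (forall t, (t < p)%N -> w1 (alpha t) (alpha t.+1) = w2 (alpha t) (alpha t.+1)) ->
  valuation w1 p alpha = valuation w2 p alpha.
Proof. by move=> w12; apply: eq_big_nat => t /andP[_ /w12]. Qed.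

Lemma valuation_neqNy w p alpha :
  (forall a b, w a b != -oo%E) -> valuation w p alpha != -oo%E.
Proof.
move=> wNy; elim: p => [|p IH]; first by rewrite /valuation big_nil.
by rewrite valuationS adde_eq_ninfty negb_or IH wNy.
Qed.

Lemma valuation_fin_num w p alpha t :
  valuation w p alpha \is a fin_num -> (t < p)%N ->
  w (alpha t) (alpha t.+1) \is a fin_num.
Proof.
by move=> /sum_fin_numP h tp; apply: (h t); rewrite // mem_index_iota.
Qed.

(** Simple walks have fewer than [n] edges, so there are finitely many up to values beyond the last
    vertex. The relation [Q] serves both for a free starting point and for two fixed ends. *)
Lemma minimal_simple_walk w (Q : 'I_n -> 'I_n -> Prop) :
  (exists p alpha, simple_walk p alpha /\ Q (alpha 0%N) (alpha p)) ->
  exists p alpha, [/\ simple_walk p alpha, Q (alpha 0%N) (alpha p)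
    & forall q beta, simple_walk q beta -> Q (beta 0%N) (beta q) ->
        (valuation w p alpha <= valuation w q beta)%E].
Proof.
(* A walk is encoded by its length and a table of vertices; indices up to [p < n] survive
   [inord]. *)
pose T := ('I_n.+1 * {ffun 'I_n.+1 -> 'I_n})%type.
pose walk (x : T) t := x.2 (inord t).
have enc p alpha : simple_walk p alpha ->
    exists2 x : T, x.1 = p :> nat & forall t, (t <= p)%N -> walk x t = alpha t.
  move=> /simple_walk_ltn pn.
  exists (inord p, [ffun t : 'I_n.+1 => alpha t]) => [|t tp] /=.
    by rewrite inordK // ltnW.
  by rewrite /walk ffunE inordK // ltnS (leq_trans tp (ltnW pn)).
have encP p alpha (x : T) : x.1 = p :> nat ->
    (forall t, (t <= p)%N -> walk x t = alpha t) ->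
    simple_walk p alpha -> Q (alpha 0%N) (alpha p) ->
    `[< simple_walk x.1 (walk x) /\ Q (walk x 0%N) (walk x x.1) >].
  move=> xp xa aw aQ; apply/asboolP; rewrite xp; split; last by rewrite !xa.
  by move=> s t sp tp; rewrite !xa //; apply: aw.
move=> [p [alpha [aw aQ]]]; have [x0 x0p x0a] := enc _ _ aw.
pose P (x : T) := `[< simple_walk x.1 (walk x) /\ Q (walk x 0%N) (walk x x.1) >].
have Px0 : P x0 by exact: encP x0a aw aQ.
pose F (x : T) := valuation w x.1 (walk x).
case: (@arg_minP _ _ _ x0 P F Px0) => x /asboolP[xw xQ] xmin.
exists x.1, (walk x); split=> // q beta bw bQ.
have [y yq yb] := enc _ _ bw.
rewrite -(eq_valuation _ yb) -yq; apply: xmin.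
exact: encP yb bw bQ.
Qed.

(** The potential [d b] is the least valuation of a simple walk ending at [b] from any start, that
    is, the distance from an extra source joined to every vertex by an edge of weight 0. *)
Lemma potential_exists w :
  (forall a b, w a b != -oo%E) ->
  (forall p alpha, simple_cycle p alpha -> (0 <= valuation w p alpha)%E) ->
  exists d : 'I_n -> R, forall a b, ((d b)%:E <= (d a)%:E + w a b)%E.
Proof.
move=> wNy cyc_ge0.
have minw b : exists e : R,
    (exists p alpha, [/\ simple_walk p alpha, alpha p = b
       & e%:E = valuation w p alpha]) /\
    (forall q beta, simple_walk q beta -> beta q = b ->
       (e%:E <= valuation w q beta)%E).
  have triv : simple_walk 0 (fun _ : nat => b) by case=> [|?] [|?].
  have [|p [alpha [aw ab amin]]] := @minimal_simple_walk w (fun _ y => y = b).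
    by exists 0%N, (fun=> b).
  (* The walk with no edge bounds the minimum by 0, which excludes [+oo]. *)
  have fin : valuation w p alpha \is a fin_num.
    rewrite fin_numE valuation_neqNy //=; apply/eqP => ay.
    by have := amin _ _ triv erefl; rewrite ay /valuation big_nil.
  exists (fine (valuation w p alpha)); rewrite fineK //; split=> //.
  by exists p, alpha.
have [d dP] := choice minw; exists d => a b.
have [[p [alpha [aw aa ->]]] _] := dP a; have [_ dmin] := dP b.
case: (pselect (exists2 s, (s <= p)%N & alpha s = b)) => [[s sp asb]|nb].
  (* [b] is already on the walk: the edge [a -> b] closes a simple cycle. *)
  have sw : simple_walk s alpha.
    by move=> x y xs ys; apply: aw; [exact: leq_trans xs sp|exact: leq_trans ys sp].
  (* The prefix up to [s] bounds [d b]; the rest of the walk followed by the edge is the cycle, of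
     nonnegative valuation. *)
  apply: (le_trans (dmin _ _ sw asb)).
  have -> : p = (s + (p - s))%N by lia.
  rewrite valuationD -addeA leeDl //.
  pose beta t := if (t <= p - s)%N then alpha (s + t)%N else b.
  have -> : valuation w (p - s) (fun t => alpha (s + t)%N)
      = valuation w (p - s) beta.
    by apply: eq_valuation => t tp; rewrite /beta tp.
  have -> : w a b = w (beta (p - s)%N) (beta (p - s).+1).
    by rewrite /beta leqnn ltnn subnKC // aa.
  rewrite -valuationS; apply: cyc_ge0; split=> //.
    by rewrite /beta ltnn /= addn0.
  move=> x y; rewrite !ltnS /beta => xs ys; rewrite xs ys => /aw xy.
  have : (s + x = s + y)%N by apply: xy; lia.
  lia.
(* Otherwise appending [b] keeps the walk simple and makes it a competitor for [d b]. *)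
pose beta t := if (t <= p)%N then alpha t else b.
have -> : valuation w p alpha = valuation w p beta.
  by apply: eq_valuation => t tp; rewrite /beta tp.
have -> : w a b = w (beta p) (beta p.+1) by rewrite /beta leqnn ltnn aa.
rewrite -valuationS; apply: dmin; last by rewrite /beta ltnn.
move=> x y xp yp; rewrite /beta.
have [xp'|xp'] := leqP x p; have [yp'|yp'] := leqP y p.
- exact: aw.
- by move=> e; case: nb; exists x.
- by move=> e; case: nb; exists y.
- by move=> _; lia.
Qed.

(** Each weight dominates a difference of [d], and these telescope. Repeated vertices are harmless,
    so closed walks that are not simple are covered. *)
Lemma valuation_ge_potential w (d : 'I_n -> R) p alpha :
  (forall a b, ((d b)%:E <= (d a)%:E + w a b)%E) ->
  ((d (alpha p) - d (alpha 0%N))%:E <= valuation w p alpha)%E.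
Proof.
move=> dP; elim: p => [|p IH]; first by rewrite /valuation big_nil subrr.
rewrite valuationS.
have -> : d (alpha p.+1) - d (alpha 0%N)
    = (d (alpha p) - d (alpha 0%N)) + (d (alpha p.+1) - d (alpha p)) by ring.
rewrite EFinD; apply: leeD => //.
by rewrite EFinB leeBlDl.
Qed.

(* Adding an edge [j -> i] of weight [- L], where [L] is the distance from [i]
   to [j], creates no negative cycle; a potential for the augmented graph
   realises that distance. *)
Lemma shortest_path_potential w (i j : 'I_n) (L : R) :
  (forall a b, w a b != -oo%E) ->
  (forall p alpha, simple_cycle p alpha -> (0 <= valuation w p alpha)%E) ->
  (forall p alpha, is_path i j p alpha -> (L%:E <= valuation w p alpha)%E) ->
  exists d : 'I_n -> R,
    (forall a b, ((d b)%:E <= (d a)%:E + w a b)%E) /\ d i + L <= d j.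
Proof.
move=> wNy cyc_ge0 L_le.
pose w' a b := if (a == j) && (b == i) then Order.min (w a b) (- L)%:E else w a b.
have w'_le a b : (w' a b <= w a b)%E.
  by rewrite /w'; case: ifP => // _; rewrite ge_min lexx.
have [||d dP] := @potential_exists w'.
- by move=> a b; rewrite /w'; case: ifP => // _; rewrite /Order.min; case: ifP.
- move=> p alpha cyc; have := cyc; move=> [p0 ap inj_a].
  case: (pselect (exists2 t, (t < p)%N &
      w' (alpha t) (alpha t.+1) != w (alpha t) (alpha t.+1))); last first.
    move=> ne; rewrite (@eq_valuation_weight w' w); first exact: cyc_ge0.
    move=> t tp; apply/eqP; apply: contrapT => /negP h.
    by apply: ne; exists t.
  move=> [t tp]; rewrite {1}/w'; case: ifP => [/andP[/eqP atj /eqP ati]|];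
    last by rewrite eqxx.
  have [_|Lw _] := leP (w (alpha t) (alpha t.+1)) (- L)%:E; first by rewrite eqxx.
  (* Only edges with tail [j] can change weight, and a simple cycle leaves [j] once. *)
  have w'E s : (s < p)%N -> s != t ->
      w' (alpha s) (alpha s.+1) = w (alpha s) (alpha s.+1).
    move=> sp st; rewrite /w'; case: eqP => //= asj.
    by case/eqP: st; apply: inj_a => //; rewrite asj.
  (* Removing the edge [j -> i] at position [t] and rotating the cycle leaves a path [beta] from [i]
     to [j], with [m] edges after position [t] and then the first [t] edges. Its valuation is at
     least [L], which compensates the weight [- L]. *)
  pose m := (p - t.+1)%N.
  pose beta s := if (s < m)%N then alpha (t.+1 + s)%N else alpha (s - m)%N.
  have bm s : (s <= m)%N -> beta s = alpha (t.+1 + s)%N.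
    rewrite leq_eqVlt /beta => /predU1P[->|->//].
    by rewrite ltnn subnn -ap /m subnKC.
  have b_path : is_path i j (m + t) beta.
    split; first by rewrite bm // addn0.
      by rewrite /beta ltnNge leq_addr /= addKn.
    move=> x y xp yp; rewrite /beta.
    case: ltnP => xm; case: ltnP => ym => /inj_a; rewrite /m in xm ym xp yp * => e;
      (have {}e := e _ _); lia.
  have := L_le _ _ b_path; rewrite valuationD.
  rewrite (@eq_valuation w m beta (fun s => alpha (t.+1 + s)%N)) //.
  rewrite (@eq_valuation w t (fun s => beta (m + s)%N) alpha); last first.
    by move=> s _; rewrite /beta ltnNge leq_addr /= addKn.
  rewrite -(@eq_valuation_weight w' w t alpha); last first.
    by move=> s st; rewrite w'E //; lia.
  rewrite -(@eq_valuation_weight w' w m); last first.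
    by move=> s sm; rewrite addnS w'E //; rewrite /m in sm; lia.
  have -> : valuation w' p alpha = valuation w' (t.+1 + m) alpha.
    by rewrite /m subnKC.
  rewrite valuationD valuationS.
  have -> : w' (alpha t) (alpha t.+1) = (- L)%:E.
    by rewrite /w' atj ati !eqxx /= min_r // -atj -ati ltW.
  rewrite addeAC (addeC (valuation w' t alpha)) EFinN => h.
  by rewrite sube_ge0.
- exists d; split.
    by move=> a b; apply: le_trans (dP a b) _; rewrite leeD2l.
  have : ((d i)%:E <= (d j)%:E + (- L)%:E)%E.
    apply: le_trans (dP j i) _; rewrite leeD2l // /w' !eqxx /=.
    by rewrite ge_min lexx orbT.
  by rewrite -EFinD lee_fin; lra.
Qed.

End Valuation.

(** * Linear maximisation over a feasible set and finiteness of weights *)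

Section Feasible.
Variables (R : realType) (n : nat).
Implicit Types (J : {set 'I_n}) (c : 'I_n -> R) (u v : 'rV[R]_n).
Implicit Types (rho : 'I_n -> \bar R).

Definition dot c u : R := \sum_(a < n) c a * u 0 a.

Lemma dotD c u v : dot c (u + v) = dot c u + dot c v.
Proof. by rewrite -big_split; apply: eq_bigr => a _; rewrite mxE mulrDr. Qed.

Lemma dotN c u : dot c (- u) = - dot c u.
Proof. by rewrite -sumrN; apply: eq_bigr => a _; rewrite mxE mulrN. Qed.

Lemma dot_sum c (I : Type) (s : seq I) (P : pred I) (u : I -> 'rV[R]_n) :
  dot c (\sum_(x <- s | P x) u x) = \sum_(x <- s | P x) dot c (u x).
Proof.
apply: (big_morph (dot c)); first exact: dotD.
by rewrite /dot big1 // => a _; rewrite mxE mulr0.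
Qed.

Lemma dot_addl c1 c2 u : dot (fun a => c1 a + c2 a) u = dot c1 u + dot c2 u.
Proof. by rewrite -big_split; apply: eq_bigr => a _; rewrite mulrDl. Qed.

Lemma dot_basis c a : dot c (basis_vec R a) = c a.
Proof.
rewrite /dot (bigD1 a) //= mxE !eqxx mulr1 big1 ?addr0 // => b ba.
by rewrite mxE (negbTE ba) andbF mulr0.
Qed.

(** A polytope containing the convex hull of [feasible J r]; its linear constraints are all that the
    bounds on hull points use. *)
Definition relaxed J (r : nat) : set 'rV[R]_n :=
  [set u | [/\ forall a, 0 <= u 0 a <= 1, \sum_(a < n) u 0 a = r%:R
             & forall a, a \in J -> u 0 a = 0]].

Lemma feasible_relaxed J r : @feasible R n J r `<=` relaxed J r.
Proof.
move=> u [u01 usum uJ]; split=> // a.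
by case: (u01 a) => ->; rewrite ?lexx ler01.
Qed.

Lemma convex_hull_relaxed J r :
  convex_hull (@feasible R n J r) `<=` relaxed J r.
Proof.
move=> u [m [c [y [c0 c1 yF ->]]]].
have E a : (\sum_(l < m) c l *: y l) 0 a = \sum_(l < m) c l * y l 0 a.
  by rewrite summxE; apply: eq_bigr => l _; rewrite mxE.
have yR l := feasible_relaxed (yF l).
split=> [a||a aJ].
- rewrite E; apply/andP; split.
    apply: sumr_ge0 => l _; rewrite mulr_ge0 //.
    by have [/(_ a)/andP[]] := yR l.
  rewrite -c1; apply: ler_sum => l _; rewrite ler_piMr //.
  by have [/(_ a)/andP[]] := yR l.
- under eq_bigr do rewrite E.
  transitivity (\sum_(l < m) c l * r%:R); last by rewrite -mulr_suml c1 mul1r.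
  rewrite exchange_big; apply: eq_bigr => l _.
  by rewrite -mulr_sumr; have [_ -> _] := yR l.
- rewrite E big1 // => l _; have [_ _ ->] := yR l; rewrite ?mulr0 //.
Qed.

Lemma sub_convex_hull (A : set 'rV[R]_n) : A `<=` convex_hull A.
Proof.
move=> u Au; exists 1%N, (fun=> 1), (fun=> u); split=> //.
- by rewrite big_ord1.
- by rewrite big_ord1 scale1r.
Qed.

(** On [J] the coordinates of [u] vanish, so [-oo] and its image under [fine] both contribute 0; off
    [J] the values are finite. *)
Lemma pairing_dot J r rho u :
  (forall a, (rho a < +oo)%E) -> (forall a, rho a = -oo%E <-> a \in J) ->
  relaxed J r u -> pairing rho u = (dot (fun a => fine (rho a)) u)%:E.
Proof.
move=> rho_lty rhoJ [_ _ uJ]; rewrite /pairing /dot -sumEFin.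
apply: eq_bigr => a _; case: (boolP (a \in J)) => [aJ|aJ].
  by rewrite uJ // mule0 mulr0.
rewrite EFinM fineK // fin_numE; apply/andP; split.
  by apply/eqP => /rhoJ; apply/negP.
by rewrite lt_eqF.
Qed.

(* With [theta] the least value of [c] on the support of [u], every term of
   [\sum_a (c a - theta) * (v a - u a)] is nonpositive. *)
Lemma feasible_dot_max J r c u v :
  feasible J r u -> relaxed J r v ->
  (forall a b, u 0 a = 1 -> u 0 b = 0 -> b \notin J -> c b <= c a) ->
  dot c v <= dot c u.
Proof.
move=> [u01 usum uJ] [v01 vsum vJ] cP.
suff [theta thP] : exists theta : R,
    forall a, (c a - theta) * v 0 a <= (c a - theta) * u 0 a.
  (* Both vectors have coordinate sum [r], so the terms in [theta] cancel after summation. *)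
  have : \sum_(a < n) (c a - theta) * v 0 a <= \sum_(a < n) (c a - theta) * u 0 a.
    exact: ler_sum.
  have E x : \sum_(a < n) (c a - theta) * (x : 'rV[R]_n) 0 a
      = dot c x - theta * \sum_(a < n) x 0 a.
    rewrite mulr_sumr -sumrB; apply: eq_bigr => a _; ring.
  by rewrite !E usum vsum lerD2r.
(* With empty support the coordinate sum is 0, which forces [v = 0] too, and any [theta] works. *)
case: (pselect (exists a0, u 0 a0 == 1)) => [[a0 ua0]|none]; last first.
  have u0 a : u 0 a = 0.
    by case: (u01 a) => // /eqP ua; case: none; exists a.
  have v0 a : v 0 a = 0.
    have : \sum_(a < n) v 0 a == 0 by rewrite vsum -usum big1.
    rewrite psumr_eq0 => [|b _]; last by have /andP[] := v01 b.
    by move=> /allP/(_ a) /(_ (mem_index_enum a)) /eqP.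
  by exists 0 => a; rewrite u0 v0.
case: (@arg_minP _ _ _ a0 (fun a => u 0 a == 1) c ua0) => a1 /eqP ua1 amin.
exists (c a1) => a; have /andP[va0 va1] := v01 a.
case: (u01 a) => ua; rewrite ua.
  case: (boolP (a \in J)) => aJ; first by rewrite vJ.
  by rewrite mulr0 mulr_le0_ge0 // subr_le0; apply: cP.
by rewrite ler_wpM2l // subr_ge0; apply: amin; apply/eqP.
Qed.

Lemma edge_weight_neqNy J r rho u a b :
  (forall a, (rho a < +oo)%E) -> (forall a, rho a = -oo%E <-> a \in J) ->
  feasible J r u -> edge_weight rho u a b != -oo%E.
Proof.
move=> rho_lty rhoJ [_ _ uJ]; rewrite /edge_weight; case: ifP => // /andP[/eqP ua _].
rewrite adde_eq_ninfty negb_or; apply/andP; split.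
  by apply/eqP => /rhoJ /uJ; rewrite ua => /eqP; rewrite oner_eq0.
by have := rho_lty b; case: (rho b).
Qed.

(** If [b] were in [J], then [rho b = -oo] would make the weight infinite. Finite valuation thus
    ensures that an exchange never puts a unit on a forbidden index. *)
Lemma edge_weight_fin J r rho u a b :
  (forall a, (rho a < +oo)%E) -> (forall a, rho a = -oo%E <-> a \in J) ->
  feasible J r u -> edge_weight rho u a b \is a fin_num ->
  [/\ u 0 a = 1, u 0 b = 0, b \notin J
    & edge_weight rho u a b = (fine (rho a) - fine (rho b))%:E].
Proof.
move=> rho_lty rhoJ [_ _ uJ]; rewrite /edge_weight; case: ifP => // /andP[/eqP ua /eqP ub].
rewrite fin_numD fin_numN => /andP[ra rb]; split=> //.
  by apply/negP => /rhoJ rb'; rewrite rb' in rb.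
by rewrite EFinB !fineK.
Qed.

(** The sum counts the preimages of [a], of which there is at most one; it is used for the units
    that a vertex loses or gains. *)
Lemma sum_eq_injective (I : finType) (P : pred I) (f : I -> 'I_n) (a : 'I_n) :
  injective f ->
  let S := \sum_(t | P t) (f t == a)%:R : R in S = 0 \/ S = 1.
Proof.
move=> f_inj; case: (pselect (exists2 t, P t & f t = a)) => [[t Pt ft]|none] /=.
  right; rewrite (bigD1 t) //= ft eqxx big1 ?addr0 // => s /andP[_ st].
  by case: eqP => // fs; case/eqP: st; apply: f_inj; rewrite ft.
left; rewrite big1 // => t Pt; case: eqP => // ft.
by case: none; exists t.
Qed.

End Feasible.

(** * Effect of an exchange on sums, costs and feasibility *)

Section Exchange.
Variables (R : realType) (n K : nat).
Implicit Types (rho : 'I_K -> 'I_n -> \bar R) (u : 'I_K -> 'rV[R]_n).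

Lemma graph_weight_attained rho u a b :
  (0 < K)%N -> exists k, edge_weight (rho k) (u k) a b = graph_weight rho u a b.
Proof.
move=> K0; rewrite /graph_weight.
have [||k _ ->] := @eq_bigmin _ _ _ +oo%E (Ordinal K0) xpredT
  (fun k => edge_weight (rho k) (u k) a b); first by [].
- by move=> k _; rewrite leey.
- by exists k.
Qed.

Lemma graph_weight_le rho u a b k :
  (graph_weight rho u a b <= edge_weight (rho k) (u k) a b)%E.
Proof. exact: bigmin_le_cond. Qed.

Variables (u : 'I_K -> 'rV[R]_n) (p : nat) (alpha : nat -> 'I_n)
  (ks : 'I_p -> 'I_K).

(** Regrouping the moves by their index [ks t] gives one sum over the edges, which telescopes. *)
Lemma sum_exchange :
  \sum_(k < K) exchange u alpha ks k
  = \sum_(k < K) u k - basis_vec R (alpha 0%N) + basis_vec R (alpha p).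
Proof.
rewrite big_split /= -addrA; congr (_ + _).
transitivity (\sum_(t < p) (- basis_vec R (alpha t) + basis_vec R (alpha t.+1))).
  by rewrite [RHS](partition_big ks xpredT).
rewrite -(big_mkord xpredT (fun t => - basis_vec R (alpha t) + basis_vec R (alpha t.+1))).
under eq_bigr do rewrite addrC.
by rewrite telescope_sumr // addrC.
Qed.

(** When [c k] is the finite part of [rho k] and [ks] selects minimising indices of finite weight,
    the subtracted sum is the valuation. *)
Lemma dot_exchange (c : 'I_K -> 'I_n -> R) :
  \sum_(k < K) dot (c k) (exchange u alpha ks k)
  = \sum_(k < K) dot (c k) (u k)
    - \sum_(t < p) (c (ks t) (alpha t) - c (ks t) (alpha t.+1)).
Proof.
rewrite (partition_big ks xpredT) //= -sumrB; apply: eq_bigr => k _.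
rewrite dotD dot_sum -sumrN; congr (_ + _); apply: eq_bigr => t /eqP ->.
by rewrite dotD dotN !dot_basis opprB addrC.
Qed.

Lemma exchange_feasible (J : {set 'I_n}) (r : nat) (k : 'I_K) :
  feasible J r (u k) ->
  injective (fun t : 'I_p => alpha t) ->
  injective (fun t : 'I_p => alpha t.+1) ->
  (forall t, ks t = k -> [/\ u k 0 (alpha t) = 1, u k 0 (alpha t.+1) = 0
     & alpha t.+1 \notin J]) ->
  feasible J r (exchange u alpha ks k).
Proof.
move=> [u01 usum uJ] out_inj in_inj edgeP.
(* Units of [k] leaving and entering [a]: each count is 0 or 1, the first vanishes where [u k] is 0,
   the second where [u k] is 1 or on [J]. *)
pose out a : R := \sum_(t < p | ks t == k) (alpha t == a)%:R.
pose inn a : R := \sum_(t < p | ks t == k) (alpha t.+1 == a)%:R.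
have E a : exchange u alpha ks k 0 a = u k 0 a - out a + inn a.
  rewrite mxE summxE -addrA -sumrN -big_split; congr (_ + _).
  by apply: eq_bigr => t _; rewrite !mxE /= ![a == _]eq_sym.
have out0 a : u k 0 a = 0 -> out a = 0.
  move=> ua; apply: big1 => t /eqP /edgeP[ut _ _]; case: eqP => // ta.
  by move: ut; rewrite ta ua => /eqP; rewrite eq_sym oner_eq0.
have inn0 a : u k 0 a = 1 \/ a \in J -> inn a = 0.
  move=> h; apply: big1 => t /eqP /edgeP[_ ut tJ]; case: eqP => // ta.
  case: h => [|aJ]; last by rewrite ta aJ in tJ.
  by rewrite -ta ut => /eqP; rewrite eq_sym oner_eq0.
split=> [a||a aJ].
- rewrite E; case: (u01 a) => ua.
    rewrite out0 // ua subr0 add0r.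
    exact: (@sum_eq_injective R n _ _ (fun t : 'I_p => alpha t.+1)).
  rewrite inn0 ?ua ?addr0; last by left.
  have : out a = 0 \/ out a = 1 by exact: sum_eq_injective out_inj.
  by case=> ->; rewrite ?subr0 ?subrr; [right|left].
- have dot1 (v : 'rV[R]_n) : \sum_(a < n) v 0 a = dot (fun=> 1) v.
    by apply: eq_bigr => a _; rewrite mul1r.
  rewrite dot1 dotD -dot1 usum dot_sum big1 ?addr0 // => t _.
  by rewrite dotD dotN !dot_basis addNr.
- by rewrite E uJ // out0 ?uJ // inn0; [rewrite subr0 addr0|right].
Qed.

End Exchange.

(** * Optimality of the exchange along a shortest path *)

Theorem theorem4 (R : realType) (n K : nat) (n_ge1 : (1 <= n)%N)
    (K_ge1 : (1 <= K)%N)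
    (J : 'I_K -> {set 'I_n}) (r : 'I_K -> nat) (rho : 'I_K -> 'I_n -> \bar R)
    (rho_lty : forall k a, (rho k a < +oo)%E)
    (rho_Noo : forall k a, rho k a = -oo%E <-> a \in J k)
    (F := fun k => @feasible R n (J k) (r k))
    (psi := inf_convolution (fun k => cost (J k) (r k) (rho k)))
    (N : 'rV[R]_n) (N_in : set_sum F N)
    (ustar : 'I_K -> 'rV[R]_n) (ustar_in : forall k, F k (ustar k))
    (N_sum : N = \sum_(k < K) ustar k)
    (ustar_opt : psi N = (- \sum_(k < K) pairing (rho k) (ustar k))%E)
    (w := graph_weight rho ustar)
    (i j : 'I_n)
    (ij_path : exists p alpha,
       is_path i j p alpha /\ valuation w p alpha \is a fin_num) :
  [/\ set_sum F (N - basis_vec R i + basis_vec R j),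
      no_negative_cycle w,
      exists p alpha, is_shortest_path w i j p alpha
    & forall (p : nat) (alpha : nat -> 'I_n) (ks : 'I_p -> 'I_K),
        is_shortest_path w i j p alpha ->
        (forall t : 'I_p,
           edge_weight (rho (ks t)) (ustar (ks t)) (alpha t) (alpha t.+1)
           = w (alpha t) (alpha t.+1)) ->
        psi (N - basis_vec R i + basis_vec R j)
        = (- \sum_(k < K) pairing (rho k) (exchange ustar alpha ks k))%E].
Proof.
(* On relaxed points the objective is the real number [- D v], so the comparisons below are between
   reals. *)
pose c k a := fine (rho k a).
pose D (v : 'I_K -> 'rV[R]_n) := \sum_(k < K) dot (c k) (v k).
have pairingD v : (forall k, relaxed (J k) (r k) (v k)) ->
    (- \sum_(k < K) pairing (rho k) (v k))%E = (- D v)%:E.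
  move=> vR; rewrite EFinN -sumEFin; congr (- _)%E; apply: eq_bigr => k _.
  exact: pairing_dot (rho_lty k) (rho_Noo k) (vR k).
have costE k v : convex_hull (F k) v ->
    cost (J k) (r k) (rho k) v = (- dot (c k) v)%:E.
  move=> vH; rewrite /cost mem_set // EFinN.
  by rewrite (pairing_dot (rho_lty k) (rho_Noo k) (convex_hull_relaxed vH)).
have psi_le v x : (forall k, F k (v k)) -> \sum_(k < K) v k = x ->
    (psi x <= (- D v)%:E)%E.
  move=> vF vx; apply: ereal_inf_lbound; exists v; split=> //.
  rewrite -sumrN -sumEFin; apply: eq_bigr => k _.
  by rewrite costE //; apply: sub_convex_hull.
have psiN : psi N = (- D ustar)%:E.
  by rewrite ustar_opt pairingD // => k; exact: feasible_relaxed (ustar_in k).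
have wNy a b : w a b != -oo%E.
  rewrite /w; have [k <-] := graph_weight_attained rho ustar a b K_ge1.
  exact: edge_weight_neqNy (rho_lty k) (rho_Noo k) (ustar_in k).
have ks_ex p (alpha : nat -> 'I_n) : exists ks : 'I_p -> 'I_K, forall t : 'I_p,
    edge_weight (rho (ks t)) (ustar (ks t)) (alpha t) (alpha t.+1)
    = w (alpha t) (alpha t.+1).
  have [ks ksP] := choice (fun t : 'I_p =>
    graph_weight_attained rho ustar (alpha t) (alpha t.+1) K_ge1).
  by exists ks.
(* Tails and heads are kept as separate injectivity conditions so that the claim applies to paths
   and to simple cycles alike. *)
have exchP p (alpha : nat -> 'I_n) (ks : 'I_p -> 'I_K) :
    injective (fun t : 'I_p => alpha t) ->
    injective (fun t : 'I_p => alpha t.+1) ->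
    valuation w p alpha \is a fin_num ->
    (forall t : 'I_p,
       edge_weight (rho (ks t)) (ustar (ks t)) (alpha t) (alpha t.+1)
       = w (alpha t) (alpha t.+1)) ->
    (forall k, F k (exchange ustar alpha ks k)) /\
    D (exchange ustar alpha ks) = D ustar - fine (valuation w p alpha).
  move=> out_inj in_inj val_fin ksP.
  have edge (t : 'I_p) := edge_weight_fin (rho_lty (ks t)) (rho_Noo (ks t))
    (ustar_in (ks t)) (a := alpha t) (b := alpha t.+1).
  have efin (t : 'I_p) : edge_weight (rho (ks t)) (ustar (ks t)) (alpha t) (alpha t.+1)
      \is a fin_num by rewrite ksP; apply: valuation_fin_num val_fin _.
  split=> [k|].
    apply: (exchange_feasible (ustar_in k)) => // t tk.
    by have [] := edge t (efin t); rewrite tk.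
  rewrite /D dot_exchange; congr (_ - _).
  rewrite /valuation big_mkord.
  under [X in fine X]eq_bigr => t _.
    rewrite -ksP; have [_ _ _ ->] := edge t (efin t); over.
  by rewrite sumEFin.
have cyc_ge0 p (alpha : nat -> 'I_n) :
    simple_cycle p alpha -> (0 <= valuation w p alpha)%E.
  move=> cyc; have [p0 ap inj_a] := cyc.
  have := valuation_neqNy p alpha wNy.
  case E: (valuation w p alpha) => [L| |] // _.
  have [ks ksP] := ks_ex p alpha.
  have [||| exF exD] := exchP p alpha ks _ _ _ ksP; last 1 first.
  (* An exchange around a cycle leaves the sum [N] unchanged, so its cost cannot fall below that of
     [ustar]. *)
  - have : (psi N <= (- D (exchange ustar alpha ks))%:E)%E.
      apply: psi_le => //.
      by rewrite sum_exchange ap -N_sum subrK.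
    by rewrite psiN exD E lee_fin /= lee_fin; lra.
  - by move=> s t /inj_a st; apply/val_inj/st.
  - by move=> s t /(simple_cycle_next_inj cyc) st; apply/val_inj/st.
  - by rewrite E.
have [p0 [alpha0 [[a00 a0p a0w] a0min]]] : exists p alpha, is_shortest_path w i j p alpha.
  have [|p [alpha [aw [ai aj] amin]]] :=
      @minimal_simple_walk R n w (fun x y => x = i /\ y = j).
    by move: ij_path => [p [alpha [[? ? ?] _]]]; exists p, alpha.
  exists p, alpha; split=> // q beta [bi bj bw]; exact: amin.
have a0_fin : valuation w p0 alpha0 \is a fin_num.
  move: ij_path => [p [alpha [/a0min le_pa fin]]].
  rewrite fin_numE valuation_neqNy //=; apply/eqP => y.
  by rewrite y leye_eq in le_pa; rewrite (eqP le_pa) in fin.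
have exch_path p alpha (ks : 'I_p -> 'I_K) : is_path i j p alpha ->
    valuation w p alpha \is a fin_num ->
    (forall t : 'I_p,
       edge_weight (rho (ks t)) (ustar (ks t)) (alpha t) (alpha t.+1)
       = w (alpha t) (alpha t.+1)) ->
    [/\ forall k, F k (exchange ustar alpha ks k),
        \sum_(k < K) exchange ustar alpha ks k = N - basis_vec R i + basis_vec R j
      & D (exchange ustar alpha ks) = D ustar - fine (valuation w p alpha)].
  move=> [ai aj aw] fin ksP; have [|||exF exD] := exchP p alpha ks _ _ _ ksP => //.
  - by move=> s t /aw st; apply/val_inj/st; apply: ltnW.
  - by move=> s t /aw st; apply/val_inj; have [] := st (ltn_ord s) (ltn_ord t).
  - by split=> //; rewrite sum_exchange ai aj -N_sum.
have [d0 d0P] := potential_exists wNy cyc_ge0.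
split.
- have [ks ksP] := ks_ex p0 alpha0.
  have [exF exN _] := exch_path p0 alpha0 ks (And3 a00 a0p a0w) a0_fin ksP.
  by exists (exchange ustar alpha0 ks).
- move=> [p [alpha [[_ ap] neg]]].
  have := valuation_ge_potential p alpha d0P.
  by rewrite ap subrr leNgt neg.
- by exists p0, alpha0.
move=> p alpha ks [apath amin] ksP.
have fin : valuation w p alpha \is a fin_num.
  rewrite fin_numE valuation_neqNy //=; apply/eqP => y.
  have := amin _ _ (And3 a00 a0p a0w).
  by rewrite y leye_eq => /eqP y0; rewrite y0 in a0_fin.
have [exF exN exD] := exch_path p alpha ks apath fin ksP.
rewrite pairingD; last by move=> k; exact: feasible_relaxed (exF k).
apply/eqP; rewrite eq_le psi_le //=.
set L := fine _ in exD.
(* The upper bound is given by the exchange itself; for the lower bound, [d] acts as a dual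
   certificate with [d j - d i] at least [L]. *)
have [|d [dP dij]] := @shortest_path_potential R n w i j L wNy cyc_ge0.
  by move=> q beta /amin; rewrite -[X in (X <= _)%E](fineK fin).
apply: le_ereal_inf_tmp => _ [v [vN ->]].
(* A component outside its hull costs [+oo], and no cost is [-oo], so the total is [+oo]. *)
have [vH|] := pselect (forall k, convex_hull (F k) (v k)); last first.
  move=> /existsNP[k vk].
  suff -> : (\sum_(k < K) cost (J k) (r k) (rho k) (v k) = +oo)%E by rewrite leey.
  apply/esum_eqyP.
    move=> l _; have [vl|vl] := pselect (convex_hull (F l) (v l)).
      by rewrite costE.
    by rewrite /cost memNset.
  by exists k; split; [exact: mem_index_enum| |rewrite /cost memNset].
under eq_bigr => k _ do rewrite costE //.
rewrite sumEFin sumrN lee_fin lerN2 exD.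
have opt k : dot (c k) (v k) + dot d (v k)
    <= dot (c k) (ustar k) + dot d (ustar k).
  rewrite -!dot_addl.
  apply: feasible_dot_max (ustar_in k) (convex_hull_relaxed (vH k)) _.
  move=> a b ua ub bJ.
  (* The edge [a -> b] of index [k] has weight [c k a - c k b], so the potential inequality reads
     [c k b + d b <= c k a + d a]. *)
  have := le_trans (dP a b) (leeD2l _ (graph_weight_le rho ustar a b k)).
  have fr x : x \notin J k -> (rho k x) = (c k x)%:E.
    move=> xJ; rewrite /c fineK // fin_numE (lt_eqF (rho_lty k x)) andbT.
    by apply/eqP => /rho_Noo; apply/negP.
  have aJ : a \notin J k.
    apply/negP => aJ; have [_ _ /(_ a aJ)] := ustar_in k.
    by rewrite ua => /eqP; rewrite oner_eq0.
  rewrite /edge_weight ua ub !eqxx /= !fr // -EFinB -EFinD lee_fin; lra.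
(* The two sums of vectors differ by [- e_i + e_j], so [D v] is at most [D ustar - (d j - d i)],
   hence at most [D ustar - L]. *)
have sum_opt : D v + dot d (\sum_(k < K) v k)
    <= D ustar + dot d (\sum_(k < K) ustar k).
  by rewrite /D !dot_sum -!big_split; apply: ler_sum => k _; exact: opt.
move: sum_opt; rewrite vN -N_sum !dotD dotN !dot_basis -/(D v) -/(D ustar); lra.
Qed.
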